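(* Let $f:\mathbb N\to\mathbb N$ be a function with $f(n)\to\infty$ as $n\to\infty$. For every $n$ such that $f(n)\ge 3$ and $f(n)$ divides $n-2$, let $G_n$ be the generalized theta graph with $(n-2)/f(n)$ paths each having exactly $f(n)$ internal nodes. Then $G_n$ has $n$ vertices and $n(1+1/f(n))-2(1+1/f(n))$ edges (so edge density $1+1/f(n)-\frac{2}{n}(1+1/f(n))$), and Broadcast on $G_n$ requires exactly $(n-2)/f(n)$ ignorant agents, i.e. it is solvable with $k$ ignorant agents if and only if $k\ge (n-2)/f(n)$.
   Context: Generalized theta graph: two distinct fixed nodes (the poles) joined by internally vertex-disjoint paths, each path having a prescribed number of internal nodes. Edge density of a graph with $m$ edges and $n$ nodes is $m/n$. Broadcast model: a connected base graph $G=(V,E)$ with $n$ nodes. There is one source agent holding a message $\mathcal M$ and $k\ge1$ ignorant agents (agents not holding $\mathcal M$); initially all agents occupy pairwise distinct nodes, the initial placement being chosen by the adversary. Time proceeds in synchronous rounds; in each round: (1) the adversary removes a (possibly empty) set $E'\subseteq E$ of edges such that $(V,E\setminus E')$ is connected; (2) each agent (agents have unique IDs, local memory, and see the entire current graph, the positions of all agents and which agents hold $\mathcal M$) chooses either to stay or to traverse an edge of $E\setminus E'$ incident to its current node; (3) agents move. Whenever an ignorant agent is at the same node as an agent holding $\mathcal M$, it receives $\mathcal M$ and becomes a source agent. The adversary is adaptive and knows the agents' strategy. Broadcast is solvable on $G$ with $k$ ignorant agents if the agents have a strategy such that, for every initial placement and every adversary behaviour, after finitely many rounds all agents hold $\mathcal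 M$; otherwise the adversary is said to have a winning strategy. *)

(* Defs.v *)
From HB Require Import structures.
From mathcomp Require Import all_boot all_order all_algebra.

Set Implicit Arguments.
Unset Strict Implicit.
Unset Printing Implicit Defensive.

Section Broadcast.
Variables (V : finType) (E : {set {set V}}).

Definition present_rel (P : {set {set V}}) : rel V :=
  fun u v => [set u; v] \in P.

Definition graph_connected (P : {set {set V}}) : Prop :=
  forall x y : V, connect (present_rel P) x y.

Definition valid_removal (R : {set {set V}}) : Prop :=
  R \subset E /\ graph_connected (E :\: R).

(* k ignorant agents plus one source agent: agents are 'I_k.+1,
   agent ord0 is the source. *)
Variable k : nat.
Local Notation A := ('I_k.+1).

(* configuration: positions of agents, and the set of agents holding M *)
Definition config := ({ffun A -> V} * {set A})%type.

Definition step (P : {set {set V}}) (m : {ffun A -> V}) (c : config) : config :=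
  let pos' := [ffun a => if (m a == c.1 a) || ([set c.1 a; m a] \in P)
                         then m a else c.1 a] in
  (pos', c.2 :|: [set a | [exists b in c.2, pos' b == pos' a]]).

(* A (joint, deterministic, full-information) strategy: the targets in the
   current round as a function of the initial placement and the sequence of
   removed edge sets of all rounds so far (including the current one).  Since
   everything else observable is determined by these, this is the most
   general strategy of agents with unique IDs, memory and global vision. *)
Definition strategy := {ffun A -> V} -> seq {set {set V}} -> {ffun A -> V}.

Fixpoint run (sigma : strategy) (p0 : {ffun A -> V})
    (R : nat -> {set {set V}}) (t : nat) : config :=
  match t with
  | 0 => (p0, [set ord0])
  | t'.+1 => step (E :\: R t') (sigma p0 [seq R i | i <- iota 0 t])
                  (run sigma p0 R t')
  end.

Definition broadcast_solvable : Prop :=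
  exists sigma : strategy,
    forall p0 : {ffun A -> V}, injective p0 ->
    forall R : nat -> {set {set V}}, (forall t, valid_removal (R t)) ->
    exists t, (run sigma p0 R t).2 = [set: A].

End Broadcast.

(* Generalized theta graph with p paths of q internal nodes each.      *)
(* Poles: inl false, inl true.  Internal node j of path i: inr (i, j); *)
(* path i is  inl false - (i,0) - (i,1) - ... - (i,q-1) - inl true.    *)
Definition theta_V (p q : nat) : finType := (bool + 'I_p * 'I_q)%type.

Definition theta_adj (p q : nat) : rel (theta_V p q) :=
  fun u v =>
    match u, v with
    | inl false, inr (_, j) => nat_of_ord j == 0
    | inr (_, j), inl true => nat_of_ord j == q.-1
    | inr (i, j), inr (i', j') => (i == i') && ((nat_of_ord j).+1 == j')
    | _, _ => false
    end.

Definition theta_E (p q : nat) : {set {set theta_V p q}} :=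
  [set e : {set theta_V p q} |
     [exists u : theta_V p q, exists v : theta_V p q,
        theta_adj u v && (e == [set u; v])]].

(* Main.v *)
(** On the generalized theta graph a legal removal cuts every path at most once
    and leaves at least one path intact.

    With fewer ignorant agents than paths the adversary keeps the source alone.
    While the source sits at a pole, every path carrying an ignorant agent is
    cut next to that pole. While the source is inside a path, the invariant is
    that the pole it came from, and the part of the path behind it, are free of
    ignorant agents: the edge in front of the source and the edges through which
    ignorant agents would enter that pole are cut. A spare path always exists;
    if every ignorant agent is about to enter the pole, the edge in front of the
    source need not be cut.

    With at least as many ignorant agents as paths, a further agent can always
    be informed. An agent between two agents of the other kind on one path is
    squeezed, as only one of its sides can be cut. Two agents on a common path
    walking apart bring one of them to a pole, where it stays as an anchor. Then
    agents of the other kind walk towards the anchor and agents of the anchor's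
    kind towards the opposite pole, one front agent per path, while the others
    return to their own pole and wait for an intact path without front agent;
    every removal lets somebody progress, until a meeting or a squeeze. *)

Require Import Defs.
From mathcomp Require Import all_boot all_order all_algebra.
From mathcomp Require Import zify ring.

Set Implicit Arguments.
Unset Strict Implicit.
Unset Printing Implicit Defensive.

(** * Auxiliary facts on pairs, connectivity and sums *)

Lemma set2_eqP (T : finType) (u v x y : T) :
  [set u; v] = [set x; y] -> (u = x /\ v = y) \/ (u = y /\ v = x).
Proof.
move=> e.
have: u \in [set x; y] by rewrite -e !inE eqxx.
have: v \in [set x; y] by rewrite -e !inE eqxx orbT.
have: x \in [set u; v] by rewrite e !inE eqxx.
have: y \in [set u; v] by rewrite e !inE eqxx orbT.
by rewrite !inE; do 4![case/orP=> /eqP ?]; subst; auto.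
Qed.

Lemma connect_invariant (T : finType) (e : rel T) (K : pred T) x y :
  (forall u v, K u -> e u v -> K v) -> connect e x y -> K x -> K y.
Proof.
move=> hK /connectP [s es ->]; elim: s x es => //= a s IH x /andP[exa es] Kx.
by apply: IH => //; apply: hK exa.
Qed.

Lemma ltn_sum1 (I : finType) (F G : I -> nat) i0 :
  (forall i, F i <= G i) -> F i0 < G i0 -> \sum_i F i < \sum_i G i.
Proof.
move=> h lt0; rewrite (bigD1 i0) //= [X in _ < X](bigD1 i0) //=.
have : \sum_(i | i != i0) F i <= \sum_(i | i != i0) G i by apply: leq_sum.
lia.
Qed.

(** * Coordinates on the theta graph, its size, and the shape of legal removals *)

Section Theta.
Variables p q : nat.
Local Notation V := (theta_V p q).
Local Notation E := (theta_E p q).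
Implicit Types (u v : V) (o : bool) (b : 'I_p) (h : nat) (R : {set {set V}}).

Definition path_of v : option 'I_p := if v is inr (b, _) then Some b else None.

(** Heights are counted from either pole [inl o], so that later arguments cover both directions at
    once. A pole has the same height on every path. *)
Definition height o v : nat :=
  match v with
  | inl x => if x == o then 0 else q.+1
  | inr (_, j) => if o then q - j else j.+1
  end.

(* The vertex at height [h] on path [b], counted from the pole [inl o]; the
   two poles are at heights [0] and [q.+1] of every path. *)
Definition node o b h : V :=
  if h == 0 then inl o
  else if insub h.-1 is Some j then inr (b, if o then rev_ord j else j)
  else inl (~~ o).

Definition edge o b h : {set V} := [set node o b h; node o b h.+1].

(** Poles belong to every path; a vertex is then determined by any path through it and its
    height. *)
Definition on_path b v := (path_of v == None) || (path_of v == Some b).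

Lemma height_le o v : height o v <= q.+1.
Proof. by case: v => [x|[b [j hj]]] /=; case: o => /=; try case: x => /=; lia. Qed.

Lemma heightN o v : height (~~ o) v = q.+1 - height o v.
Proof. by case: v => [x|[b [j hj]]] /=; case: o => /=; try case: x => /=; lia. Qed.

Lemma node0 o b : node o b 0 = inl o.
Proof. by []. Qed.

Lemma nodeS o b : node o b q.+1 = inl (~~ o).
Proof. by rewrite /node /=; case: insubP => //= j; rewrite ltnn. Qed.

Lemma node_inner o b h (lt : h < q) :
  node o b h.+1 = inr (b, if o then rev_ord (Ordinal lt) else Ordinal lt).
Proof. by rewrite /node /= insubT. Qed.

Lemma height_node o b h : h <= q.+1 -> height o (node o b h) = h.
Proof.
case: h => [|h]; first by rewrite node0 /= eqxx.
rewrite leq_eqVlt ltnS => /orP[/eqP[->]|lt].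
  by rewrite nodeS /=; case: o.
by rewrite node_inner /=; case: o => //=; lia.
Qed.

Lemma path_of_node o b h : 0 < h -> h <= q -> path_of (node o b h) = Some b.
Proof. by case: h => // h _ lt; rewrite node_inner. Qed.

Lemma path_of_pole o v : path_of v = None <-> height o v = 0 \/ height o v = q.+1.
Proof.
case: v => [x|[b [j hj]]] /=; last by split => // -[]; case: o => /=; lia.
by split=> // _; case: ifP; auto.
Qed.

Lemma path_of_inner o v b :
  path_of v = Some b -> 0 < height o v /\ height o v <= q.
Proof. by case: v => [x|[b' [j hj]]] //= _; case: o; lia. Qed.

Lemma height0 o v : height o v = 0 -> v = inl o.
Proof. by case: v => [x|[b [j hj]]] /=; case: o => /=; try case: x => /=; do ?[by []]; lia. Qed.

Lemma heightS o v : height o v = q.+1 -> v = inl (~~ o).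
Proof. by case: v => [x|[b [j hj]]] /=; case: o => /=; try case: x => /=; do ?[by []]; lia. Qed.

Lemma on_path_node o b h : h <= q.+1 -> on_path b (node o b h).
Proof.
case: h => [//|h]; rewrite leq_eqVlt ltnS => /orP[/eqP[->]|lt].
  by rewrite nodeS.
by rewrite node_inner /on_path /= eqxx ?orbT.
Qed.

Lemma node_height o b v : on_path b v -> node o b (height o v) = v.
Proof.
case: v => [x|[b' j]].
  move=> _ /=; have [->|ne] := eqVneq x o; rewrite ?node0 ?nodeS //.
  by case: x o ne => [] [].
rewrite /on_path /= => /eqP[<-]; have hj := ltn_ord j; case: o; last first.
  by rewrite node_inner; congr (inr (_, _)); apply: val_inj.
have -> : q - j = (q - j.+1).+1 by lia.
have lt : q - j.+1 < q by lia.
rewrite (node_inner _ _ lt); congr (inr (_, _)); apply: val_inj => /=; lia.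
Qed.

Lemma vertex_eq o b u v :
  on_path b u -> on_path b v -> height o u = height o v -> u = v.
Proof. by move=> hu hv e; rewrite -(node_height o hu) e node_height. Qed.

Lemma path_on_path b v : path_of v = Some b -> on_path b v.
Proof. by rewrite /on_path => ->; rewrite eqxx orbT. Qed.

Lemma nodeN o b h : h <= q.+1 -> node (~~ o) b h = node o b (q.+1 - h).
Proof.
move=> le; apply: (@vertex_eq o b); rewrite ?on_path_node //; try lia.
by have := heightN (~~ o) (node (~~ o) b h); rewrite negbK => ->; rewrite !height_node; lia.
Qed.

Lemma edgeN o b h : h <= q -> edge (~~ o) b h = edge o b (q - h).
Proof.
move=> le; rewrite /edge !nodeN; try lia.
by rewrite subSn // subSS setUC.
Qed.

Hypothesis q_gt0 : 0 < q.

Lemma edge_in o b h : h <= q -> edge o b h \in E.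
Proof.
suff H h' : h' <= q -> edge false b h' \in E.
  case: o => le; last exact: H.
  by rewrite -[true]/(~~ false) edgeN //; apply: H; lia.
move=> le; rewrite inE; apply/existsP; exists (node false b h').
apply/existsP; exists (node false b h'.+1); rewrite eqxx andbT.
case: h' le => [|h1] le; first by rewrite node0 node_inner.
have lt1 : h1 < q by lia.
rewrite (node_inner _ _ lt1); have [lt|ge] := ltnP h1.+1 q.
  by rewrite (node_inner _ _ lt) /= !eqxx.
have -> : h1.+2 = q.+1 by lia.
rewrite nodeS /=; lia.
Qed.

Lemma edgeP o u v : [set u; v] \in E ->
  exists b h, h <= q /\ ((u = node o b h /\ v = node o b h.+1) \/
                         (v = node o b h /\ u = node o b h.+1)).
Proof.
have nodeE i (j : 'I_q) : inr (i, j) = node false i j.+1.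
  by rewrite -[LHS](@node_height false i) // /on_path /= eqxx.
have main x y : theta_adj x y -> exists b h,
    [/\ h <= q, x = node false b h & y = node false b h.+1].
  case: x => [[]|[i j]]; case: y => [[]|[i' j']] //=.
  - by move/eqP=> e; exists i', 0; split=> //; rewrite nodeE e.
  - move/eqP=> e; exists i, j.+1; split; [by have := ltn_ord j | exact: nodeE |].
    have -> : j.+2 = q.+1 by have := ltn_ord j; lia.
    by rewrite nodeS.
  - case/andP=> /eqP<- /eqP e; exists i, j.+1.
    by split; [have := ltn_ord j | exact: nodeE | rewrite nodeE e].
rewrite inE => /existsP[x /existsP[y /andP[/main[b [h [le ex ey]]] /eqP e]]].
have {}e : (u = x /\ v = y) \/ (v = x /\ u = y).
  by case: (set2_eqP e) => -[]; auto.
case: o; last by exists b, h; split=> //; rewrite -ex -ey.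
exists b, (q - h); split; first lia.
rewrite -[true]/(~~ false) !nodeN; try lia.
have -> : q.+1 - (q - h) = h.+1 by lia.
have -> : q.+1 - (q - h).+1 = h by lia.
by rewrite -ex -ey; case: e => -[-> ->]; auto.
Qed.

Lemma node_inj o b b' h : 0 < h -> h <= q -> node o b h = node o b' h -> b = b'.
Proof. by move=> h0 hq /(congr1 path_of); rewrite !path_of_node // => -[]. Qed.

(** Since [0 < q], every edge has an internal endpoint, and this endpoint determines the path. *)
Lemma edge_inj o b b' h h' : h <= q -> h' <= q ->
  edge o b h = edge o b' h' -> b = b' /\ h = h'.
Proof.
move=> le le' /set2_eqP e.
have hh : h = h'.
  by case: e => -[/(congr1 (height o)) + /(congr1 (height o))];
     rewrite !height_node; lia.
subst h'; split=> //; case: e => -[e1 e2]; last first.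
  by move/(congr1 (height o)): e1; rewrite !height_node; lia.
by case: h le le' e1 e2 => [|h] ? _ e1 e2; [apply: node_inj e2 | apply: node_inj e1].
Qed.

Lemma card_theta_V : #|V| = p * q + 2.
Proof. by rewrite card_sum card_bool card_prod !card_ord addnC. Qed.

Lemma card_theta_E : #|E| = p * q.+1.
Proof.
have -> : E = [set edge false x.1 x.2 | x : 'I_p * 'I_q.+1].
  apply/setP => e; apply/idP/imsetP => [eE|[[b h] _ ->]]; last first.
    by apply: edge_in; rewrite -ltnS.
  have [u [v e_uv]] : exists u v, e = [set u; v].
    by move: eE; rewrite inE => /existsP[u /existsP[v /andP[_ /eqP]]]; exists u, v.
  move: eE; rewrite e_uv => /(edgeP false) [b [h [le H]]].
  have lt : h < q.+1 by [].
  exists (b, Ordinal lt) => //; rewrite /edge /=.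
  by case: H => -[-> ->] //; rewrite setUC.
rewrite card_imset ?card_prod ?card_ord // => -[b h] [b' h'] /=.
by case/edge_inj; rewrite -1?ltnS // => -> /val_inj ->.
Qed.

(** Two cuts on one path would disconnect the segment between them from the poles. *)
Lemma cut_uniq R o b h h' : valid_removal E R -> h <= q -> h' <= q ->
  edge o b h \in R -> edge o b h' \in R -> h = h'.
Proof.
move=> [_ conn]; wlog lt : h h' / h < h'.
  move=> W; case: (ltngtP h h') => // lt; first exact: W.
  by move=> *; symmetry; apply: W.
move=> le le' c c'.
pose K v := [&& path_of v == Some b, h < height o v & height o v <= h'].
have inv u v : K u -> present_rel (E :\: R) u v -> K v.
  move=> /and3P[/eqP pu l1 l2]; rewrite /present_rel inE => /andP[nR] /(edgeP o).
  case=> b' [k [lek [[eu ev]|[ev eu]]]].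
    have hu : height o u = k by rewrite eu height_node //; lia.
    have eb : b' = b by move: pu; rewrite eu path_of_node; [case|lia|lia].
    have ne : k <> h' by move=> e; move: nR; rewrite eu ev eb e c'.
    by rewrite /K ev eb height_node ?path_of_node ?eqxx; lia.
  have hu : height o u = k.+1 by rewrite eu height_node //; lia.
  have eb : b' = b by move: pu; rewrite eu path_of_node; [case|lia|lia].
  have ne : k <> h by move=> e; move: nR; rewrite eu ev eb e setUC c.
  by rewrite /K ev eb height_node ?path_of_node ?eqxx; lia.
have := connect_invariant inv (conn (node o b h') (inl o)).
rewrite /K path_of_node ?height_node ?eqxx /=; lia.
Qed.

(** If every path were cut, no remaining edge would leave the side of the cuts that contains
    [inl o]. *)
Lemma intact_path R o : valid_removal E R ->
  exists b, forall h, h <= q -> edge o b h \notin R.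
Proof.
move=> [_ conn].
have [/existsP[b /forallP H]|] :=
  boolP [exists b, [forall h : 'I_q.+1, edge o b h \notin R]].
  by exists b => h; rewrite -ltnS => lt; apply: (H (Ordinal lt)).
rewrite negb_exists => /forallP H.
have {H} /fin_all_exists [f hf] : forall b, exists h : 'I_q.+1, edge o b h \in R.
  move=> b; move: (H b); rewrite negb_forall => /existsP[h].
  by rewrite negbK; exists h.
pose K v := if path_of v is Some b then height o v <= f b else height o v == 0.
have inv u v : K u -> present_rel (E :\: R) u v -> K v.
  rewrite /present_rel inE => Ku /andP[nR] /(edgeP o).
  case=> b' [k [lek [[eu ev]|[ev eu]]]].
    have ne : k <> f b' by move=> e; move: nR; rewrite eu ev e hf.
    have hk : k < f b'.
      suff : k <= f b' by lia.
      case: (posnP k) => [->//|k0].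
      by move: Ku; rewrite /K eu path_of_node ?height_node //; lia.
    have := ltn_ord (f b') => ?.
    by rewrite /K ev path_of_node ?height_node //; lia.
  have ne : k <> f b' by move=> e; move: nR; rewrite eu ev e setUC hf.
  case: (posnP k) => [k0|k0]; first by rewrite /K ev k0 node0 /= eqxx.
  rewrite /K ev path_of_node ?height_node //; try lia.
  move: Ku; rewrite /K eu; have [lt|ge] := ltnP k q.
    rewrite path_of_node ?height_node //; lia.
  have -> : k = q by lia.
  by rewrite nodeS /=; case: (o).
have := connect_invariant inv (conn (inl o) (inl (~~ o))).
by rewrite /K /= eqxx => /(_ isT); case: (o).
Qed.

End Theta.

Arguments node {p q} o b h.
Arguments edge {p q} o b h.

(** * The broadcast game played from an arbitrary configuration *)

Section Wins.
Variables (V : finType) (E : {set {set V}}) (k : nat).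
Local Notation A := ('I_k.+1).
Implicit Types (R : nat -> {set {set V}}) (c : config V k).

(** Deciding validity allows a response to be chosen for every removal, with a dummy one for invalid
    removals. *)
Lemma valid_removal_dec (X : {set {set V}}) :
  reflect (valid_removal E X)
    ((X \subset E) && [forall x, forall y, connect (present_rel (E :\: X)) x y]).
Proof.
apply: (iffP andP) => -[sXE conn]; split=> //.
  by move=> x y; move/forallP: conn => /(_ x)/forallP.
by apply/forallP => x; apply/forallP => y; apply: conn.
Qed.

Fixpoint run_from (tau : seq {set {set V}} -> {ffun A -> V}) c R t : config V k :=
  if t is t'.+1 then
    step (E :\: R t') (tau [seq R i | i <- iota 0 t]) (run_from tau c R t')
  else c.

Lemma run_fromE sigma (p0 : {ffun A -> V}) R t :
  run E sigma p0 R t = run_from (sigma p0) (p0, [set ord0]) R t.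
Proof. by elim: t => //= t ->. Qed.

Definition wins c := exists tau, forall R, (forall t, valid_removal E (R t)) ->
  exists t, (run_from tau c R t).2 = [set: A].

Lemma wins_done c : c.2 = [set: A] -> wins c.
Proof. by exists (fun=> c.1) => R _; exists 0. Qed.

(** There are finitely many removals, so a first move and a continuation can be fixed for each and
    glued into one strategy. *)
Lemma wins_step c :
  (forall X, valid_removal E X -> exists m, wins (step (E :\: X) m c)) -> wins c.
Proof.
move=> H.
have /fin_all_exists [f hf] : forall X, exists mt : _ * _,
    valid_removal E X -> forall R, (forall t, valid_removal E (R t)) ->
    exists t, (run_from mt.2 (step (E :\: X) mt.1 c) R t).2 = [set: A].
  move=> X; have [/H[m [tau htau]]|nv] := valid_removal_dec X.
    by exists (m, tau).
  by exists (c.1, fun=> c.1).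
(* The first removal selects the continuation, which then sees only the rest of the history; the
   value on the empty history is a default. *)
pose tau (h : seq {set {set V}}) :=
  if h is X :: h' then if h' is [::] then (f X).1 else (f X).2 h' else c.1.
exists tau => R vR.
have [t ht] := hf (R 0) (vR 0) (fun t => R t.+1) (fun t => vR t.+1).
exists t.+1; rewrite -ht; congr (_.2).
elim: t {ht} => [|t IH] //; rewrite [LHS]/= -/(run_from _ _ _ t.+1) IH /=.
by rewrite (iotaDl 1 1) -map_comp.
Qed.

Lemma wins_solvable :
  (forall p0 : {ffun A -> V}, injective p0 -> wins (p0, [set ord0])) ->
  broadcast_solvable E k.
Proof.
move=> H; have /fin_all_exists [f hf] : forall p0 : {ffun A -> V}, exists tau,
    injective p0 -> forall R, (forall t, valid_removal E (R t)) ->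
    exists t, (run_from tau (p0, [set ord0]) R t).2 = [set: A].
  move=> p0; have [/H[tau htau]|ninj] := injectiveP p0; first by exists tau.
  by exists (fun=> p0).
exists f => p0 inj R vR; have [t ht] := hf p0 inj R vR.
by exists t; rewrite run_fromE.
Qed.

Definition separated (C : pred A) (pos : {ffun A -> V}) :=
  forall a b, C a -> ~~ C b -> pos a != pos b.

Definition upd (pos : {ffun A -> V}) a v : {ffun A -> V} :=
  [ffun x => if x == a then v else pos x].

(* [C] is the set of informed agents or its complement: the meeting game is
   symmetric in the two kinds of agents. One agent moves at a time. *)
Definition forced (C : pred A) (Q : {ffun A -> V} -> Prop) :=
  forall pos : {ffun A -> V}, (forall X, valid_removal E X -> exists a v,
      [set pos a; v] \in E :\: X /\ (separated C (upd pos a v) -> Q (upd pos a v))) ->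
  Q pos.

Lemma separatedN C pos : separated (predC C) pos -> separated C pos.
Proof. by move=> H a b Ca nCb; rewrite eq_sym; apply: H => //=; rewrite negbK. Qed.

Lemma forcedN C Q : forced C Q -> forced (predC C) Q.
Proof.
move=> H pos hpos; apply: H => X /hpos [a [v [av hQ]]]; exists a, v; split=> //.
move=> sep; apply: hQ => x y /=; rewrite negbK => nCx Cy.
by rewrite eq_sym; apply: sep.
Qed.

(** A newly informed agent shares its node with an agent informed earlier, so everybody on that node
    is informed in the same round. *)
Lemma step_separated P m c : separated (mem (step P m c).2) (step P m c).1.
Proof.
move=> a b /=; set pos' := [ffun _ => _].
rewrite !inE negb_or => Ha /andP[_ nb]; apply/eqP => eab; case/negP: nb.
case/orP: Ha => [ac|/existsP[x /andP[xc /eqP ex]]]; apply/existsP.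
  by exists a; rewrite ac eab eqxx.
by exists x; rewrite xc ex eab eqxx.
Qed.

(* Informing a new agent is progress, so it is enough to force either such a
   meeting or a winning placement with the same informed set. *)
Lemma wins_forced (S : {set A}) :
  (forall c, S \proper c.2 -> separated (mem c.2) c.1 -> wins c) ->
  forced (mem S) (fun pos => wins (pos, S)).
Proof.
move=> IH pos H; apply: wins_step => X /H [a [v [av hQ]]].
exists (upd pos a v); set c := step _ _ _.
have e1 : c.1 = upd pos a v.
  apply/ffunP => x; rewrite !ffunE /=.
  by case: (x =P a) => [->|_]; rewrite ?av ?eqxx ?orbT.
have sep : separated (mem c.2) c.1 by apply: step_separated.
have sub : S \subset c.2 by apply: subsetUl.
have [e2|ne] := eqVneq c.2 S; last first.
  by apply: IH => //; rewrite properEneq eq_sym ne.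
rewrite e1 e2 in sep.
by rewrite [c]surjective_pairing e1 e2; apply: hQ.
Qed.

End Wins.

(** * Upper bound: with at least as many ignorant agents as paths, a meeting is forced *)

Section UpperBound.
Variables (p q k : nat).
Hypothesis q_gt0 : 0 < q.
Local Notation V := (theta_V p q).
Local Notation E := (theta_E p q).
Local Notation A := ('I_k.+1).
Implicit Types (pos : {ffun A -> V}) (o : bool) (b : 'I_p) (R : {set {set V}}).

Section Forced.
Variables (C : pred A) (Q : {ffun A -> V} -> Prop).
Hypothesis forcedQ : forced E C Q.

Definition can_force R pos := exists a v,
  [set pos a; v] \in E :\: R /\ (separated C (upd pos a v) -> Q (upd pos a v)).

Lemma climb R pos o b a (h := height o (pos a)) :
    on_path b (pos a) -> h <= q -> edge o b h \notin R ->
    (separated C (upd pos a (node o b h.+1)) -> Q (upd pos a (node o b h.+1))) ->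
  can_force R pos.
Proof.
move=> onp le nR H; exists a, (node o b h.+1); split=> //.
by rewrite -{1}(node_height o onp) inE -/h nR edge_in.
Qed.

Lemma descend R pos o b a (h := height o (pos a)) :
    on_path b (pos a) -> 0 < h -> edge o b h.-1 \notin R ->
    (separated C (upd pos a (node o b h.-1)) -> Q (upd pos a (node o b h.-1))) ->
  can_force R pos.
Proof.
move=> onp lt nR H; exists a, (node o b h.-1); split=> //.
have le := height_le o (pos a).
have -> : [set pos a; node o b h.-1] = edge o b h.-1.
  by rewrite /edge prednK // setUC /h node_height.
by rewrite inE nR edge_in // /h; lia.
Qed.

Lemma updE pos a v : upd pos a v a = v.
Proof. by rewrite ffunE eqxx. Qed.

Lemma updNE pos a v x : x != a -> upd pos a v x = pos x.
Proof. by rewrite ffunE => /negPf ->. Qed.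

Lemma neq_color x y : C x != C y -> x != y.
Proof. by apply: contraNneq => ->. Qed.

(* A removal cuts a path at most once, so [y] cannot be protected from both
   of its neighbours of the other colour. *)
Lemma squeeze n pos o b x y z :
    height o (pos z) - height o (pos x) <= n ->
    C x = C z -> C y != C x ->
    on_path b (pos x) -> on_path b (pos z) -> path_of (pos y) = Some b ->
    height o (pos x) < height o (pos y) -> height o (pos y) < height o (pos z) ->
  Q pos.
Proof.
move=> + Cxz Cyx; elim: n pos => [|n IH] pos hn onx onz py xy yz; first lia.
have zle := height_le o (pos z); have ony := path_on_path py.
have nyx := neq_color Cyx; have Cyz : C y != C z by rewrite -Cxz.
have nyz := neq_color Cyz.
have nxz : x != z by apply: contraTneq yz => <-; rewrite -leqNgt ltnW.
(* A placement where [y] meets an agent of the other colour is not separated, so nothing remains to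
   be forced there. *)
have nsep pos' w : C y != C w -> pos' y = pos' w -> ~ separated C pos'.
  move=> Cyw e sep; case: (boolP (C y)) => Cy.
    have nCw : ~~ C w by move: Cyw; rewrite Cy; case: (C w).
    by have := sep y w Cy nCw; rewrite e eqxx.
  have Cw : C w by move: Cyw Cy; case: (C w) => //; case: (C y).
  by have := sep w y Cw Cy; rewrite e eqxx.
have nsepx pos' := nsep pos' x Cyx; have nsepz pos' := nsep pos' z Cyz.
have updx v : upd pos x v y = pos y /\ upd pos x v z = pos z.
  by rewrite !updNE // eq_sym.
have updz v : upd pos z v y = pos y /\ upd pos z v x = pos x by rewrite !updNE.
apply: forcedQ => R vR; clear Cxz Cyx Cyz nyx nyz nxz nsep.
have [cx|ncx] := boolP (edge o b (height o (pos x)) \in R); last first.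
  have lex : height o (pos x) <= q by clear -xy yz zle; lia.
  apply: (climb onx lex ncx) => sep.
  set pos' := upd _ _ _ in sep *.
  have ex : pos' x = node o b (height o (pos x)).+1 by rewrite updE.
  have [ey ez] : pos' y = pos y /\ pos' z = pos z by apply: updx.
  have hx : height o (pos' x) = (height o (pos x)).+1 by rewrite ex height_node.
  have onx' : on_path b (pos' x) by rewrite ex on_path_node.
  have [e|ne] := eqVneq (height o (pos' x)) (height o (pos y)).
    by case: (nsepx pos') => //; apply: (vertex_eq (o := o) (b := b)); rewrite ?ey.
  by apply: (IH pos'); rewrite ?ez ?ey //; clear -hn xy yz hx ne; lia.
have ncz : edge o b (height o (pos z)).-1 \notin R.
  apply/negP => cz; have := cut_uniq q_gt0 vR _ _ cx cz; clear -xy yz zle; lia.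
have z_gt0 : 0 < height o (pos z) by apply: leq_trans yz.
have lez : (height o (pos z)).-1 <= q.+1 by apply: leq_trans (leq_pred _) zle.
apply: (descend onz z_gt0 ncz) => sep.
set pos' := upd _ _ _ in sep *.
have ez : pos' z = node o b (height o (pos z)).-1 by rewrite updE.
have [ey ex] : pos' y = pos y /\ pos' x = pos x by apply: updz.
have hz : height o (pos' z) = (height o (pos z)).-1 by rewrite ez height_node.
have onz' : on_path b (pos' z) by rewrite ez on_path_node.
have [e|ne] := eqVneq (height o (pos' z)) (height o (pos y)).
  by case: (nsepz pos') => //; apply: (vertex_eq (o := o) (b := b)); rewrite ?ey.
by apply: (IH pos'); rewrite ?ex ?ey //; clear -hn xy yz hz ne; lia.
Qed.

Section Anchor.
Variables (o : bool) (z t : A).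
Hypotheses (Cz : ~~ C z) (Ct : C t).

(** Both poles carry an agent of the colour of [z], so [t] is squeezed on whichever path it
    stands. *)
Lemma squeeze_poles pos a : height o (pos z) = q.+1 ->
  separated C pos -> ~~ C a -> height o (pos a) = 0 -> Q pos.
Proof.
move=> hz sep Ca ha.
have eaz : C a = C z by rewrite (negPf Ca) (negPf Cz).
case e: (path_of (pos t)) => [b|]; last first.
  move/(path_of_pole o): e => [e|e].
    have := sep t a Ct Ca; by rewrite (height0 e) (height0 ha) eqxx.
  have := sep t z Ct Cz; by rewrite (heightS e) (heightS hz) eqxx.
have [l1 l2] := path_of_inner o e.
apply: (@squeeze _ pos o b a t z (leqnn _)); rewrite ?ha ?hz //.
- by rewrite Ct (negPf Ca).
- by rewrite /on_path (path_of_pole o (pos a)).2 //; left.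
- by rewrite /on_path (path_of_pole o (pos z)).2 //; right.
Qed.

(* Agents of the colour of the anchor attack the pole [inl o], the others the
   pole of the anchor; the home of an agent is the pole it does not attack. *)
Definition goal_dist pos a :=
  if C a then q.+1 - height o (pos a) else height o (pos a).

Definition home_dist pos a :=
  if C a then height o (pos a) else q.+1 - height o (pos a).

(** A path without front counts [q.+1], more than any agent inside it, so naming a front lowers the
    sum. *)
Definition front_dist pos (fr : 'I_p -> option A) b :=
  if fr b is Some a then goal_dist pos a else q.+1.

(* The anchor [z] stays at its pole. Each path [b] has at most one designated
   front agent [fr b] that heads for its goal; all other agents go back home,
   where they wait for an intact path without front. *)
Lemma anchored pos (fr : 'I_p -> option A) : p <= k ->
    height o (pos z) = q.+1 -> separated C pos ->
    (forall b a, fr b = Some a -> path_of (pos a) = Some b) ->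
  Q pos.
Proof.
move=> le_pk.
(* Lexicographic induction: first the total distance of the fronts to their goals, then the total
   distance of all agents to their homes. *)
have [N] := ubnP (\sum_b front_dist pos fr b); elim: N pos fr => // N IHN pos fr.
have [M] := ubnP (\sum_a home_dist pos a); elim: M pos => // M IHM pos.
move=> hM hN hz sep hfr.
have [/existsP[a /andP[Ca /eqP ha]]|noF] :=
  boolP [exists a, ~~ C a && (height o (pos a) == 0)].
  exact: squeeze_poles ha.
have pz : path_of (pos z) = None by apply/(path_of_pole o); right.
(* A [C] agent above an agent of the anchor's colour on the same path is squeezed between that agent
   and [z]. *)
have [/existsP[a /existsP[x /existsP[b]]]|noS] := boolP [exists a, exists x, exists b,
    [&& ~~ C a, C x, path_of (pos a) == Some b, path_of (pos x) == Some b
      & height o (pos a) < height o (pos x)]].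
  case/and5P=> Ca Cx /eqP pa /eqP px lt; have [l1 l2] := path_of_inner o px.
  apply: (@squeeze _ pos o b a x z (leqnn _)); rewrite ?hz //; try exact: path_on_path.
  - by rewrite (negPf Ca) (negPf Cz).
  - by rewrite Cx (negPf Ca).
  - by rewrite /on_path pz.
have ordered a x b : ~~ C a -> C x -> path_of (pos a) = Some b ->
    path_of (pos x) = Some b -> height o (pos x) < height o (pos a).
  move=> Ca Cx pa px.
  case: (ltngtP (height o (pos x)) (height o (pos a))) => // [lt|e].
    case/negP: noS; apply/existsP; exists a; apply/existsP; exists x.
    by apply/existsP; exists b; rewrite Ca Cx pa px eqxx lt.
  have := sep x a Cx Ca; rewrite (vertex_eq (b := b) _ _ e) ?eqxx //; exact: path_on_path.
(* An agent closer to its goal than the front of its path takes over as front, which lowers the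
   first measure. *)
have [/existsP[e /existsP[c /andP[/eqP pe lt]]]|noE] := boolP [exists e, exists c,
    (path_of (pos e) == Some c) && (goal_dist pos e < front_dist pos fr c)].
  pose fr' b := if b == c then Some e else fr b.
  apply: (IHN pos fr') => //; last first.
    by move=> b a; rewrite /fr'; case: eqP => [-> [<-]|_ /hfr].
  have : \sum_b front_dist pos fr' b < \sum_b front_dist pos fr b; last lia.
  apply: (ltn_sum1 (i0 := c)); last by rewrite {1}/front_dist /fr' eqxx.
  by move=> b; rewrite {1}/front_dist /fr'; case: eqP => // ->; apply: ltnW.
have {noE} best e c : path_of (pos e) = Some c ->
    front_dist pos fr c <= goal_dist pos e.
  move=> pe; rewrite leqNgt; apply: contra noE => lt.
  by apply/existsP; exists e; apply/existsP; exists c; rewrite pe eqxx.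
have fr_uniq b b' a : fr b = Some a -> fr b' = Some a -> b = b'.
  by move=> /hfr + /hfr => -> [].
have fr_ltn b f pos' : fr b = Some f -> (forall x, x != f -> pos' x = pos x) ->
    goal_dist pos' f < goal_dist pos f ->
    \sum_b front_dist pos' fr b < \sum_b front_dist pos fr b.
  move=> fb hx lt; apply: (ltn_sum1 (i0 := b)); last by rewrite /front_dist fb.
  move=> c; rewrite /front_dist; case fc: (fr c) => [a|] //.
  have [->|ne] := eqVneq a f; first exact: ltnW.
  by rewrite /goal_dist hx.
have front_up R b f : fr b = Some f -> C f ->
    edge o b (height o (pos f)) \notin R -> can_force R pos.
  move=> fb Cf nR; have pf := hfr _ _ fb; have [l1 l2] := path_of_inner o pf.
  have nzf : z != f by apply: contraNneq Cz => ->.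
  apply: (climb (path_on_path pf)) nR _ => // {}sep.
  set pos' := upd _ _ _ in sep *; set h := height o (pos f) in l1 l2 *.
  have ef : pos' f = node o b h.+1 by rewrite updE.
  have ex x : x != f -> pos' x = pos x by apply: updNE.
  have hf : height o (pos' f) = h.+1 by rewrite ef height_node.
  (* From height [q] the climb would end on the node of the anchor, against separation. *)
  have lt : h < q.
    rewrite ltn_neqAle l2 andbT; apply/eqP => e.
    by have := sep f z Cf Cz; rewrite (ex z nzf) ef e nodeS (heightS hz) eqxx.
  apply: (IHN pos' fr) => //; last 2 first.
  - by rewrite ex.
  - move=> c a fc; have [e|ne] := eqVneq a f; last by rewrite ex // (hfr _ _ fc).
    by rewrite e in fc *; rewrite (fr_uniq _ _ _ fc fb) ef path_of_node.
  apply: leq_trans (fr_ltn _ _ _ fb ex _) _; last by rewrite -ltnS.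
  by rewrite /goal_dist Cf hf -/h; lia.
have front_down R b f : fr b = Some f -> ~~ C f ->
    edge o b (height o (pos f)).-1 \notin R -> can_force R pos.
  move=> fb Cf nR; have pf := hfr _ _ fb; have [l1 l2] := path_of_inner o pf.
  have nzf : z != f by apply/eqP => e; move: pf; rewrite -e pz.
  apply: (descend (path_on_path pf)) nR _ => // {}sep.
  set pos' := upd _ _ _ in sep *; set h := height o (pos f) in l1 l2 *.
  have ef : pos' f = node o b h.-1 by rewrite updE.
  have ex x : x != f -> pos' x = pos x by apply: updNE.
  have hf : height o (pos' f) = h.-1 by rewrite ef height_node; lia.
  (* A front of the anchor's colour that reaches [inl o] squeezes every path at once. *)
  have [e|lt] := posnP h.-1.
    by apply: (squeeze_poles (a := f)) => //; rewrite ?(ex z nzf) ?hf.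
  apply: (IHN pos' fr) => //; last 2 first.
  - by rewrite ex.
  - move=> c a fc; have [e|ne] := eqVneq a f; last by rewrite ex // (hfr _ _ fc).
    by rewrite e in fc *; rewrite (fr_uniq _ _ _ fc fb) ef path_of_node //; lia.
  apply: leq_trans (fr_ltn _ _ _ fb ex _) _; last by rewrite -ltnS.
  by rewrite /goal_dist (negPf Cf) hf -/h; lia.
have retreat e v : e != z -> (forall b, fr b != Some e) -> separated C (upd pos e v) ->
    home_dist (upd pos e v) e < home_dist pos e -> Q (upd pos e v).
  move=> nez efr {}sep lt; have ex x : x != e -> upd pos e v x = pos x by apply: updNE.
  have nfr b a : fr b = Some a -> a != e.
    by move=> fb; apply: contraNneq (efr b) => <-; apply/eqP.
  apply: IHM => //.
  - have : \sum_a home_dist (upd pos e v) a < \sum_a home_dist pos a; last lia.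
    apply: (ltn_sum1 (i0 := e)) => // a; have [->|ne] := eqVneq a e; first exact: ltnW.
    by rewrite /home_dist ex.
  - apply: leq_ltn_trans hN; apply: leq_sum => b _; rewrite /front_dist.
    by case fb: (fr b) => [a|] //; rewrite /goal_dist ex // (nfr b).
  - by rewrite ex // eq_sym.
  - by move=> b a fb; rewrite ex ?(hfr _ _ fb) // (nfr b).
have enter e b v : e != z -> fr b = None -> (forall b, fr b != Some e) ->
    path_of v = Some b -> separated C (upd pos e v) -> Q (upd pos e v).
  move=> nez fb efr pv {}sep.
  have ex x : x != e -> upd pos e v x = pos x by apply: updNE.
  have nfr c a : fr c = Some a -> a != e.
    by move=> fc; apply: contraNneq (efr c) => <-; apply/eqP.
  have [l1 l2] := path_of_inner o pv.
  pose fr' c := if c == b then Some e else fr c.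
  apply: (IHN _ fr') => //; last 2 first.
  - by rewrite ex // eq_sym.
  - move=> c a; rewrite /fr'; case: eqP => [-> [<-]|_ fc]; first by rewrite updE.
    by rewrite ex ?(hfr _ _ fc) // (nfr c).
  have : \sum_c front_dist (upd pos e v) fr' c < \sum_c front_dist pos fr c; last lia.
  have gd : goal_dist (upd pos e v) e < q.+1.
    by rewrite /goal_dist updE; case: ifP; lia.
  apply: (ltn_sum1 (i0 := b)); last by rewrite /front_dist /fr' eqxx fb.
  move=> c; rewrite /front_dist /fr'; case: eqP => [->|_]; first by rewrite fb ltnW.
  by case fc: (fr c) => [a|] //; rewrite /goal_dist ex // (nfr c).
apply: forcedQ => R vR; rewrite -/(can_force R pos).
have [b intact] := intact_path q_gt0 o vR.
case fb: (fr b) => [f|].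
  have [l1 l2] := path_of_inner o (hfr _ _ fb).
  have [Cf|Cf] := boolP (C f); first exact: front_up fb Cf (intact _ l2).
  by apply: front_down fb Cf (intact _ _); lia.
(* As [b] has no front, there are at most [p.-1] fronts, while [k >= p] agents differ from [z]. *)
have [e nez efr] : exists2 e, e != z & forall c, fr c != Some e.
  pose T := [set e | [exists c, fr c == Some e]].
  have cT : #|T| <= #|[set~ b]|.
    apply: leq_trans (leq_imset_card (fun c => odflt z (fr c)) _).
    apply/subset_leq_card/subsetP => e; rewrite inE => /existsP[c /eqP fc].
    apply/imsetP; exists c; rewrite ?inE ?fc //.
    by apply: contra_eqN fc => /eqP->; rewrite fb.
  have /subsetPn[e] : ~~ ([set~ z] \subset T).
    apply/negP => /subset_leq_card.
    move: cT; rewrite !cardsC1 !card_ord; have := ltn_ord b; lia.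
  rewrite !inE => nez nT; exists e => // c; apply: contra nT => fc.
  by apply/existsP; exists c.
(* At a pole, [e] must be at its home, its goal being excluded by separation or by [noF]; it enters
   the intact path [b] as its front. *)
case pe: (path_of (pos e)) => [c|]; last first.
  have one : on_path b (pos e) by rewrite /on_path pe.
  move/(path_of_pole o): pe => he; have [Ce|Ce] := boolP (C e).
    have {}he : height o (pos e) = 0.
      case: he => // he.
      by have := sep e z Ce Cz; rewrite (heightS he) (heightS hz) eqxx.
    apply: (climb (o := o) one); rewrite ?he ?intact // => {}sep.
    by apply: (enter e b) sep => //; rewrite path_of_node.
  have {}he : height o (pos e) = q.+1.
    case: he => // he; case/negP: noF; apply/existsP.
    by exists e; rewrite Ce he eqxx.
  apply: (descend (o := o) one); rewrite ?he ?intact // => {}sep.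
  by apply: (enter e b) sep => //; rewrite path_of_node.
have [le1 le2] := path_of_inner o pe; have one := path_on_path pe.
have := best e c pe; rewrite {1}/front_dist; case fc: (fr c) => [f|]; last first.
  by rewrite /goal_dist; case: ifP => _; clear -le1 le2; lia.
have pf := hfr _ _ fc; have [lf1 lf2] := path_of_inner o pf.
have extra_down : C e -> edge o c (height o (pos e)).-1 \notin R -> can_force R pos.
  move=> Ce nR; apply: (descend (o := o) one) => // {}sep; apply: retreat => //.
  by rewrite /home_dist Ce updE height_node; clear -le1 le2; lia.
have extra_up : ~~ C e -> edge o c (height o (pos e)) \notin R -> can_force R pos.
  move=> Ce nR; apply: (climb (o := o) one) => // {}sep; apply: retreat => //.
  by rewrite /home_dist (negPf Ce) updE height_node; clear -le1 le2; lia.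
have nocut h h' : h <= q -> h' <= q -> h != h' -> edge o c h \in R ->
    edge o c h' \notin R.
  move=> lh lh' ne ch; apply: contraNN ne => ch'; apply/eqP.
  exact: cut_uniq vR _ _ ch ch'.
(* The edge ahead of the front [f] and the edge taking [e] homewards are distinct, by [best] for
   equal colours and by [ordered] otherwise; at most one of them is cut. *)
rewrite /goal_dist; have [Cf|Cf] := boolP (C f).
  have [cf|ncf _] := boolP (edge o c (height o (pos f)) \in R); last first.
    exact: front_up fc Cf ncf.
  have [Ce le|Ce _] := boolP (C e).
    by apply: extra_down Ce (nocut _ _ _ _ _ cf); clear -le1 le2 lf1 lf2 le; lia.
  have lt := ordered e f c Ce Cf pe pf.
  by apply: extra_up Ce (nocut _ _ _ _ _ cf); clear -le1 le2 lf1 lf2 lt; lia.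
have [cf|ncf _] := boolP (edge o c (height o (pos f)).-1 \in R); last first.
  exact: front_down fc Cf ncf.
have [Ce _|Ce le] := boolP (C e).
  have lt := ordered f e c Cf Ce pf pe.
  by apply: extra_down Ce (nocut _ _ _ _ _ cf); clear -le1 le2 lf1 lf2 lt; lia.
by apply: extra_up Ce (nocut _ _ _ _ _ cf); clear -le1 le2 lf1 lf2 le; lia.
Qed.

End Anchor.
End Forced.

(** Any agent at a pole can serve as anchor, after exchanging the colours if it lies in [C]; no
    front is designated at the start. *)
Lemma pole_forced C Q pos t t' a : forced E C Q -> p <= k -> separated C pos ->
  C t -> ~~ C t' -> path_of (pos a) = None -> Q pos.
Proof.
move=> fQ le_pk sep Ct Ct' pa.
have [o ho] : exists o, height o (pos a) = q.+1.
  case/(path_of_pole false): pa => [h|]; last by exists false.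
  by exists true; rewrite -[true]/(~~ false) heightN h subn0.
have [Ca|Ca] := boolP (C a); last first.
  exact: (@anchored C Q fQ o a t Ca Ct pos (fun=> None)).
apply: (@anchored (predC C) Q (forcedN fQ) o a t' _ Ct' pos (fun=> None)) => //=.
  by rewrite negbK.
by apply: separatedN => x y /=; rewrite !negbK; apply: sep.
Qed.

(** Only one of the two outward edges can be cut, so [x] or [y] can always walk outwards; the first
    to reach a pole becomes the anchor. *)
Lemma pair_forced n C Q pos o b x y t t' : forced E C Q -> p <= k ->
  C t -> ~~ C t' -> x != y -> separated C pos ->
  path_of (pos x) = Some b -> path_of (pos y) = Some b ->
  height o (pos x) <= height o (pos y) ->
  height o (pos x) + (q.+1 - height o (pos y)) <= n -> Q pos.
Proof.
move=> fQ le_pk Ct Ct' nxy; elim: n pos => [|n IH] pos sep px py lexy len.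
  by have [] := path_of_inner o px; lia.
have [lx1 lx2] := path_of_inner o px; have [ly1 ly2] := path_of_inner o py.
apply: (fQ) => R vR; rewrite -/(can_force C Q R pos).
have [cx|ncx] := boolP (edge o b (height o (pos x)).-1 \in R); last first.
  apply: (descend (path_on_path px) _ ncx) => // {}sep.
  set pos' := upd _ _ _ in sep *.
  have [ex ey] : pos' x = node o b (height o (pos x)).-1 /\ pos' y = pos y.
    by rewrite updE updNE // eq_sym.
  have [e|e] := posnP (height o (pos x)).-1.
    by apply: (pole_forced (a := x) fQ _ sep Ct Ct') => //; rewrite ex e.
  apply: IH; rewrite ?ex ?ey ?path_of_node ?height_node //; lia.
have ncy : edge o b (height o (pos y)) \notin R.
  by apply/negP => cy; have := cut_uniq q_gt0 vR _ _ cx cy; lia.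
apply: (climb (path_on_path py) _ ncy) => // {}sep.
set pos' := upd _ _ _ in sep *.
have [ey ex] : pos' y = node o b (height o (pos y)).+1 /\ pos' x = pos x.
  by rewrite updE updNE.
have [e|e] := eqVneq (height o (pos y)) q.
  by apply: (pole_forced (a := y) fQ _ sep Ct Ct') => //; rewrite ey e nodeS.
by apply: IH; rewrite ?ex ?ey ?path_of_node ?height_node //; lia.
Qed.

(** If nobody is at a pole, two of the [k.+1] agents share one of the [p <= k] paths. *)
Lemma separated_forced C Q pos t t' : forced E C Q -> p <= k ->
  C t -> ~~ C t' -> separated C pos -> Q pos.
Proof.
move=> fQ le_pk Ct Ct' sep.
have [/existsP[a /eqP pa]|noP] := boolP [exists a, path_of (pos a) == None].
  exact: pole_forced fQ _ sep Ct Ct' pa.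
have /fin_all_exists [f hf] : forall a, exists b, path_of (pos a) = Some b.
  move=> a; case pa: (path_of (pos a)) => [b|]; first by exists b.
  by case/existsP: noP; exists a; rewrite pa.
have [/injectiveP inj|/injectivePn[x [y nxy exy]]] := boolP (injectiveb f).
  by have := leq_card _ inj; rewrite !card_ord; lia.
have [le|/ltnW le] := leqP (height false (pos x)) (height false (pos y)).
  by apply: (pair_forced fQ _ Ct Ct' nxy sep (hf x) _ le (leqnn _)) => //; rewrite exy.
rewrite eq_sym in nxy.
by apply: (pair_forced fQ _ Ct Ct' nxy sep (hf y) _ le (leqnn _)) => //; rewrite -exy.
Qed.

Lemma theta_solvable : p <= k -> broadcast_solvable E k.
Proof.
move=> le_pk; apply: wins_solvable => p0 inj.
suff main n (c : config V k) : #|~: c.2| <= n -> ord0 \in c.2 ->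
    separated (mem c.2) c.1 -> wins E c.
  apply: (main _ _ (leqnn _)); rewrite ?inE //= => a b; rewrite !inE /= => /eqP-> ne.
  by rewrite (inj_eq inj) eq_sym.
elim: n c => [|n IH] [pos S] /= len s0 sep.
  by apply: wins_done => /=; rewrite -[S]setCK; move: len; rewrite leqn0 cards_eq0 => /eqP->; rewrite setC0.
have [->|neq] := eqVneq S [set: 'I_k.+1]; first exact: wins_done.
have /subsetPn[t' _ nt'] : ~~ ([set: 'I_k.+1] \subset S) by rewrite subTset.
apply: (@separated_forced (mem S) (fun pos => wins E (pos, S)) pos ord0 t') => //.
apply: wins_forced => c prop sepc; apply: IH => //; last first.
  by move/proper_sub/subsetP: prop; apply.
by rewrite -ltnS; apply: leq_trans len; apply: proper_card; rewrite properC.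
Qed.

End UpperBound.

(** * Lower bound: with fewer ignorant agents than paths, the source stays alone *)

Section LowerBound.
Variables (p q k : nat).
Hypothesis q_gt1 : 1 < q.
Let q_gt0 : 0 < q := ltnW q_gt1.
Local Notation V := (theta_V p q).
Local Notation E := (theta_E p q).
Local Notation A := ('I_k.+1).
Implicit Types (pos : {ffun A -> V}) (o : bool) (b : 'I_p) (g : 'I_p -> nat).

(* Path [b] is cut at height [g b]; a value [g b > q] leaves it intact. *)
Definition cuts o g : {set {set V}} := [set edge o b (g b) | b in [pred b | g b <= q]].

Lemma mem_cuts o g b h : h <= q -> (edge o b h \in cuts o g) = (g b == h).
Proof.
move=> le; apply/imsetP/eqP => [[c]|e]; last by exists b; rewrite ?inE e.
by rewrite inE => lec /(edge_inj q_gt0 le lec) [-> ->].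
Qed.

Lemma connect_segment o g b i j : i <= j -> j <= q.+1 ->
  (forall h, i <= h < j -> g b != h) ->
  connect (present_rel (E :\: cuts o g)) (node o b i) (node o b j).
Proof.
elim: j => [|j IH] lei lej hg; first by move: lei; rewrite leqn0 => /eqP->.
move: lei; rewrite leq_eqVlt => /orP[/eqP->//|lei].
apply: connect_trans (IH _ _ _) (connect1 _); try lia.
  by move=> h hh; apply: hg; lia.
by rewrite /present_rel inE -/(edge o b j) mem_cuts ?hg ?edge_in //; lia.
Qed.

(** The intact path [b0] joins the poles, and every vertex reaches the pole on its side of the
    cut. *)
Lemma cuts_valid o g b0 : q < g b0 -> valid_removal E (cuts o g).
Proof.
move=> g0; split.
  by apply/subsetP => e /imsetP[b]; rewrite inE => le ->; apply: edge_in.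
have sym : symmetric (present_rel (E :\: cuts o g)).
  by move=> u v; rewrite /present_rel setUC.
have csym := sym_connect_sym sym.
have top b : connect (present_rel (E :\: cuts o g)) (inl o) (node o b q.+1).
  rewrite nodeS -(nodeS q o b0) -(node0 q o b0).
  by apply: connect_segment => // h hh; apply/eqP; lia.
suff base v : connect (present_rel (E :\: cuts o g)) (inl o) v.
  by move=> u v; apply: connect_trans (base v); rewrite csym.
case pv: (path_of v) => [b|]; last first.
  case/(path_of_pole o): pv => [/height0->|/heightS->]; first exact: connect0.
  by have := top b0; rewrite nodeS.
have hv := height_le o v; rewrite -(node_height o (path_on_path pv)).
have [le|lt] := leqP (height o v) (g b).
  by rewrite -(node0 q o b); apply: connect_segment => // h hh; apply/eqP; lia.
apply: connect_trans (top b) _; rewrite csym.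
by apply: connect_segment => // h hh; apply/eqP; lia.
Qed.

Lemma moveP o g u v : u = v \/ [set u; v] \in E :\: cuts o g ->
  u = v \/ exists b, [/\ on_path b u, on_path b v &
    (height o v = (height o u).+1 /\ g b <> height o u) \/
    (height o u = (height o v).+1 /\ g b <> height o v)].
Proof.
case=> [|]; first by left.
rewrite inE => /andP[nc] /(edgeP q_gt0 o) [b [h [le H]]]; right; exists b.
case: H => -[eu ev]; move: nc; rewrite eu ev ?[[set node o b h.+1; _]]setUC;
  rewrite -/(edge o b h) mem_cuts // => /eqP nc;
  rewrite !on_path_node ?height_node //; try lia; split=> //; auto.
Qed.

Lemma on_path_inner o b (v : V) :
  on_path b v -> 0 < height o v -> height o v <= q -> path_of v = Some b.
Proof.
move=> + h0 hq; rewrite /on_path => /orP[/eqP|/eqP //].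
by case/(path_of_pole o); lia.
Qed.

Lemma on_path_eq b c (v : V) : on_path b v -> path_of v = Some c -> b = c.
Proof. by rewrite /on_path => + e; rewrite e => /orP[|/eqP[]]. Qed.

Lemma leq_card_paths pos (B : {set 'I_p}) (T : {set A}) :
  (forall b, b \in B -> exists2 a, a \in T & path_of (pos a) = Some b) ->
  #|B| <= #|T|.
Proof.
move=> H; have inj : injective (@Some 'I_p) by move=> x y [].
rewrite -(card_imset (mem B) inj).
apply: leq_trans (leq_imset_card (fun a => path_of (pos a)) (mem T)).
apply/subset_leq_card/subsetP => ob /imsetP[b /H[a aT pa] ->].
by apply/imsetP; exists a.
Qed.

(** Invariant of the adversary; [inl o] plays the role of the pole that the source visited last. *)
Definition evades o pos := [forall a, (a != ord0) ==> (pos a != pos ord0) &&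
  ((height o (pos ord0) == 0) ||
   [&& path_of (pos ord0) != None, height o (pos a) != 0 &
     (path_of (pos a) == path_of (pos ord0)) ==>
       (height o (pos ord0) < height o (pos a))])].

Definition keeps_evading pos := exists2 R, valid_removal E R &
  forall pos', (forall a, pos a = pos' a \/ [set pos a; pos' a] \in E :\: R) ->
  [exists o, evades o pos'].

(** Some path holds no ignorant agent and can stay intact; the source can only enter such unoccupied
    paths. *)
Lemma evade_pole o pos : k < p -> height o (pos ord0) = 0 -> evades o pos ->
  keeps_evading pos.
Proof.
move=> ltkp h0 /forallP ev.
pose occ b := [exists a, (a != ord0) && (path_of (pos a) == Some b)].
pose g b := if occ b then 0 else q.+1.
have [b0 hb0] : exists b, ~~ occ b.
  apply/existsP; rewrite -negb_forall; apply/negP => /forallP full.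
  suff : #|[set: 'I_p]| <= #|[set~ (ord0 : A)]|.
    by rewrite cardsC1 cardsT !card_ord /=; lia.
  apply: (@leq_card_paths pos) => b _; have /existsP[a /andP[na /eqP pa]] := full b.
  by exists a => //; rewrite !inE.
exists (cuts o g); first by apply: (@cuts_valid _ _ b0); rewrite /g (negPf hb0).
move=> pos' mv; apply/existsP; exists o; apply/forallP => a; apply/implyP => na.
have ne : pos a != pos ord0 by have := ev a; rewrite na => /andP[].
have ha : height o (pos a) <> 0.
  by move=> e; move: ne; rewrite (height0 e) (height0 h0) eqxx.
have ha' : height o (pos' a) <> 0.
  case/moveP: (mv a) => [<-//|[b [ob ob' [[]|[e]]]]]; first lia.
  move=> + e'; rewrite e' in e *; rewrite /g ifT // /occ; apply/existsP; exists a.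
  by rewrite na (on_path_inner (o := o) ob) ?e ?eqxx.
have [e0|ne0] := eqVneq (height o (pos' ord0)) 0.
  rewrite /= andbT; apply/eqP => e; move: ha'; rewrite e e0 //.
case/moveP: (mv ord0) => [e|[b [ob ob' []]]]; try lia.
  by rewrite -e h0 in ne0.
rewrite h0 => -[h1 gb]; have p1 : path_of (pos' ord0) = Some b.
  by apply: (on_path_inner (o := o) ob'); rewrite h1.
have nocc : ~~ occ b by apply/negP => e; apply: gb; rewrite /g e.
(* An agent newly inside [b] came from the far pole and stands at height [q], which exceeds 1. *)
have far : path_of (pos' a) = Some b -> 1 < height o (pos' a).
  move=> pa'; have pa : path_of (pos a) <> Some b.
    by move=> pa; case/negP: nocc; apply/existsP; exists a; rewrite na pa eqxx.
  case/moveP: (mv a) => [e|[c [oc oc' hc]]]; first by rewrite e in pa.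
  have ec := on_path_eq oc' pa'; subst c.
  have : height o (pos a) = q.+1.
    have le := height_le o (pos a); apply/eqP; rewrite eqn_leq le /= ltnNge.
    by apply/negP => le'; apply: pa; apply: (on_path_inner (o := o) oc _ le'); lia.
  lia.
rewrite p1 h1 /=; apply/andP; split.
  by apply/eqP => e; move: far; rewrite e p1 h1 => /(_ erefl).
by apply/andP; split; [apply/eqP | apply/implyP => /eqP].
Qed.

Lemma evade_path o pos b0 : k < p -> path_of (pos ord0) = Some b0 -> evades o pos ->
  keeps_evading pos.
Proof.
move=> ltkp p0 /forallP ev.
have [l0 lq] := path_of_inner o p0.
have evP (a : A) : a != ord0 -> [/\ pos a != pos ord0, height o (pos a) <> 0 &
    path_of (pos a) = Some b0 -> height o (pos ord0) < height o (pos a)].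
  move=> na; have := ev a; rewrite na p0 /= => /andP[ne /orP[|/andP[/eqP h1 /implyP h2]]].
    by move/eqP=> e; rewrite e in l0.
  by split=> // e; apply: h2; rewrite e.
have s_path g pos' : (forall a, pos a = pos' a \/ [set pos a; pos' a] \in E :\: cuts o g) ->
    on_path b0 (pos' ord0).
  move=> mv; case/moveP: (mv ord0) => [<-|[b [ob ob' _]]]; first exact: path_on_path.
  by rewrite -(on_path_eq ob p0).
(* If all ignorant agents are about to enter [inl o] from other paths, these paths are cut there; as
   [1 < q], the agents stay inside them and both poles are safe for the source. *)
have [/forallP D|/forallPn[a0]] := boolP [forall a, (a != ord0) ==>
    (height o (pos a) == 1) && (path_of (pos a) != Some b0)].
  pose g b := if b == b0 then q.+1 else 0.
  exists (cuts o g); first by apply: (@cuts_valid _ _ b0); rewrite /g eqxx.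
  move=> pos' mv; have on0 := s_path _ _ mv.
  have away (a : A) : a != ord0 -> exists2 c, c <> b0 & path_of (pos' a) = Some c.
    move=> na; have := D a; rewrite na /= => /andP[/eqP h1 /eqP nb].
    have [c pc] : exists c, path_of (pos a) = Some c.
      case pa: (path_of (pos a)) => [c|]; first by exists c.
      by case/(path_of_pole o): pa; rewrite h1 => -[] // [e]; move: q_gt1; rewrite -e.
    have nc : c <> b0 by move=> e; rewrite pc e in nb.
    exists c => //; case/moveP: (mv a) => [<-//|[b [ob ob' hb]]].
    have eb := on_path_eq ob pc; subst b.
    have gc : g c = 0 by rewrite /g; case: eqP.
    by apply: (on_path_inner (o := o) ob'); move: hb; rewrite h1 gc; lia.
  have apart (a : A) : a != ord0 -> pos' a != pos' ord0.
    move=> /away[c nc pc]; apply/eqP => e; apply: nc.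
    by move: on0; rewrite -e => on0; symmetry; apply: on_path_eq on0 pc.
  case p0': (path_of (pos' ord0)) => [b|]; last first.
    have [o' ho'] : exists o', height o' (pos' ord0) = 0.
      case/(path_of_pole o): p0' => [|e]; first by exists o.
      by exists (~~ o); rewrite heightN e subnn.
    apply/existsP; exists o'; apply/forallP => a; apply/implyP => na.
    by rewrite apart // ho'.
  have eb := on_path_eq on0 p0'; subst b.
  apply/existsP; exists o; apply/forallP => a; apply/implyP => na.
  have [c nc pc] := away a na; have [c0 _] := path_of_inner o pc.
  rewrite apart //= p0' pc; apply/orP; right; rewrite -lt0n c0 /=.
  by apply/implyP => /eqP[].
rewrite negb_imply negb_and negbK => /andP[na0 ha0].
pose occ b := [exists a, [&& a != ord0, path_of (pos a) == Some b & height o (pos a) == 1]].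
pose g b := if b == b0 then height o (pos ord0) else if occ b then 0 else q.+1.
(* Otherwise the [p.-1] paths other than [b0] would need distinct agents among the [k.-1] ignorant
   ones other than [a0]. *)
have [b1 nb1 hb1] : exists2 b, b != b0 & ~~ occ b.
  have [/existsP[b /andP[]]|] := boolP [exists b, (b != b0) && ~~ occ b].
    by exists b.
  rewrite negb_exists => /forallP full; exfalso.
  suff : #|[set~ b0]| <= #|[set~ (ord0 : A)] :\ a0|.
    have := cardsD1 a0 [set~ (ord0 : A)]; rewrite !inE na0 !cardsC1 !card_ord /=.
    by have := ltn_ord b0; lia.
  apply: (@leq_card_paths pos) => b; rewrite !inE => nb.
  have := full b; rewrite nb /= negbK => /existsP[a /and3P[na /eqP pa ha]].
  exists a => //; rewrite !inE na andbT; apply: contraTneq ha0 => <-.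
  by rewrite ha pa /=; apply: contra nb => /eqP[->].
exists (cuts o g).
  by apply: (@cuts_valid _ _ b1); rewrite /g (negPf nb1) (negPf hb1).
move=> pos' mv; have on0 := s_path _ _ mv.
have gb0 : g b0 = height o (pos ord0) by rewrite /g eqxx.
have le0 : height o (pos' ord0) <= height o (pos ord0).
  case/moveP: (mv ord0) => [<-//|[b [ob _ hb]]].
  by have eb := on_path_eq ob p0; subst b; lia.
(* The cut ahead of the source also stops the agents ahead of it on [b0] from descending to its old
   height. *)
have away (a : A) : a != ord0 -> height o (pos' a) <> 0 /\
    (on_path b0 (pos' a) -> height o (pos ord0) < height o (pos' a)).
  move=> na; have [ne hn0 hb] := evP a na; have lea := height_le o (pos a).
  case/moveP: (mv a) => [e|[b [ob ob' hm]]].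
    rewrite -e; split=> //; rewrite /on_path => /orP[/eqP|/eqP //].
    by case/(path_of_pole o); lia.
  have hn0' : height o (pos' a) <> 0.
    move=> e; have pa : path_of (pos a) = Some b by apply: (on_path_inner (o := o) ob); lia.
    have [eb|nb] := eqVneq b b0; first by subst b; have := hb pa; lia.
    have gb : g b = 0; last lia.
    have ha : height o (pos a) = 1 by move: hm; rewrite e; lia.
    by rewrite /g (negPf nb) ifT //; apply/existsP; exists a; rewrite na pa ha !eqxx.
  split=> // on'; have lea' := height_le o (pos' a).
  have [pc|gt] := leqP (height o (pos' a)) q; last exact: leq_ltn_trans lq gt.
  have e2 := on_path_eq ob' (on_path_inner (o := o) on' ltac:(lia) pc); subst b.
  have [leq|gt] := leqP (height o (pos a)) q; last by move: hm; rewrite gb0; lia.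
  by move: hm (hb (on_path_inner (o := o) ob ltac:(lia) leq)); rewrite gb0; lia.
apply/existsP; exists o; apply/forallP => a; apply/implyP => na.
have [ha hb] := away a na; apply/andP; split.
  by apply/eqP => e; move: hb; rewrite e => /(_ on0); lia.
have [//|ne0] := eqVneq (height o (pos' ord0)) 0.
have p0' : path_of (pos' ord0) = Some b0 by apply: (on_path_inner (o := o) on0); lia.
rewrite /= p0' /=; apply/andP; split; first exact/eqP.
by apply/implyP => /eqP/path_on_path/hb; apply: leq_ltn_trans.
Qed.

(** A source that has reached the far pole is handled with the roles of the poles exchanged. *)
Lemma evades_keeps o pos : k < p -> evades o pos -> keeps_evading pos.
Proof.
move=> ltkp ev; case p0: (path_of (pos ord0)) => [b|]; first exact: evade_path p0 ev.
have [e|ne] := eqVneq (height o (pos ord0)) 0; first exact: evade_pole e ev.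
have e : height (~~ o) (pos ord0) = 0.
  by case/(path_of_pole o): p0 => h; [rewrite h in ne | rewrite heightN h subnn].
apply: (evade_pole ltkp e); apply/forallP => a; apply/implyP => na.
by move/forallP/(_ a): ev; rewrite na e => /andP[-> _].
Qed.

Lemma stepP (P : {set {set V}}) m (c : config V k) a :
  c.1 a = (step P m c).1 a \/ [set c.1 a; (step P m c).1 a] \in P.
Proof. by rewrite /= ffunE; case: eqP => [->|_] /=; [left | case: ifP; auto]. Qed.

Lemma theta_unsolvable : 0 < k -> k < p -> ~ broadcast_solvable E k.
Proof.
move=> k_gt0 ltkp [sigma solves].
have /fin_all_exists [adv hadv] : forall pos, exists R, [exists o, evades o pos] ->
    valid_removal E R /\ forall pos',
      (forall a, pos a = pos' a \/ [set pos a; pos' a] \in E :\: R) ->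
      [exists o, evades o pos'].
  move=> pos; have [/existsP[o ev]|nev] := boolP [exists o, evades o pos].
    by have [R vR hR] := evades_keeps ltkp ev; exists R.
  by exists set0.
(* The source starts at a pole and the ignorant agents next to it on distinct paths, which exist as
   [k < p]. *)
pose p0 : {ffun A -> V} :=
  [ffun a => if unlift ord0 a is Some i
             then inr (widen_ord (ltnW ltkp) i, Ordinal q_gt0) else inl false].
have inj0 : injective p0.
  move=> a b; rewrite !ffunE.
  case: unliftP => [i ->|->]; case: unliftP => [j ->|->] // [e].
  by congr (lift _ _); apply: val_inj.
have ev0 : [exists o, evades o p0].
  apply/existsP; exists false; apply/forallP => a; apply/implyP => na.
  by rewrite (inj_eq inj0) na ffunE unlift_none.
(* The adversary reacts to positions, whereas [run] takes a fixed sequence of removals; simulating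
   the play together with its history yields that sequence. *)
pose st := fix st t : config V k * seq {set {set V}} :=
  if t is t'.+1 then
    let: (c, h) := st t' in
    (step (E :\: adv c.1) (sigma p0 (rcons h (adv c.1))) c, rcons h (adv c.1))
  else ((p0, [set ord0]), [::]).
pose R t := adv (st t).1.1.
have stR t : (st t).2 = [seq R i | i <- iota 0 t] /\ run E sigma p0 R t = (st t).1.
  elim: t => [//|t [IH1 IH2]].
  have hist : [seq R i | i <- iota 0 t.+1] = rcons (st t).2 (R t).
    by rewrite -addn1 iotaD map_cat cats1 -IH1.
  have -> : run E sigma p0 R t.+1 = step (E :\: R t)
    (sigma p0 [seq R i | i <- iota 0 t.+1]) (run E sigma p0 R t) by [].
  by rewrite hist IH2 [st t.+1]/= /R; case: (st t).
have inv t : [exists o, evades o (st t).1.1] /\ (st t).1.2 = [set ord0].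
  elim: t => [//|t [IH1 IH2]] /=; move: IH1 IH2; case: (st t) => c h /= ev cS.
  have [_ /(_ _ (stepP _ _ _)) ev'] := hadv _ ev.
  move: {ev'}(ev' (sigma p0 (rcons h (adv c.1)))) => /= ev'; split=> //.
  case/existsP: ev' => o /forallP ev'; apply/setP => a; rewrite cS !inE.
  have [//|na] := eqVneq a ord0.
  have := ev' a; rewrite na /= => /andP[ne _]; apply/existsP => -[b].
  by rewrite inE => /andP[/eqP->]; rewrite eq_sym (negPf ne).
have [|t] := solves p0 inj0 R.
  by move=> t; have [ev _] := inv t; have [] := hadv _ ev.
have [_ ->] := stR t; have [_ ->] := inv t.
move/setP/(_ (Ordinal (k_gt0 : 1 < k.+1))); rewrite !inE => /eqP.
by move/(congr1 val).
Qed.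

End LowerBound.

(** * Specialisation to paths of [f n] internal nodes *)

Theorem theorem3 (f : nat -> nat)
  (f_to_infty : forall M : nat, exists N : nat, forall m : nat, N <= m -> M <= f m)
  (n : nat) (hn : 2 <= n) (hf3 : 3 <= f n) (hdiv : f n %| n - 2) :
  let p := (n - 2) %/ f n in
  let q := f n in
  #|theta_V p q| = n /\
  ((#|theta_E p q|)%:R : rat)
     = (n%:R * (1 + (q%:R)^-1) - 2%:R * (1 + (q%:R)^-1))%R /\
  (forall k : nat, 1 <= k -> (broadcast_solvable (theta_E p q) k <-> p <= k)).
Proof.
move=> p q; have q_gt0 : 0 < q by apply: leq_trans hf3.
have n_eq : n = p * q + 2 by rewrite divnK // subnK.
split; first by rewrite card_theta_V -n_eq.
split; last first.
  move=> k k_gt0; split; last exact: theta_solvable.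
  move=> sol; rewrite leqNgt; apply/negP => ltkp.
  by apply: theta_unsolvable sol => //; apply: leq_trans hf3.
rewrite card_theta_E // n_eq; have q_neq0 : (q%:R != 0 :> rat)%R.
  by rewrite Num.Theory.pnatr_eq0 -lt0n.
rewrite GRing.natrD !GRing.natrM GRing.mulrSr; field.
exact: q_neq0.
Qed.
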